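(* Let $0<a<b\le 1$, $0<s<1$ and $q>1$. Then $$\left|A(a^{s},b^{s})-L(a^{s},b^{s})\right|\le \frac{s(b-a)}{L(a,b)\,G^{2(s-1)^2}(a,b)}\left(\frac{q-1}{2q-1}\right)^{1-\frac1q}L^{\frac1q}\bigl(a^{(s^2-s+1)q},b^{(s^2-s+1)q}\bigr)$$ and $$\left|G^{s}(a,b)-L(a^{s},b^{s})\right|\le \frac{s(b-a)}{2L(a,b)\,G^{(s-1)^2}(a,b)}\left(\frac{q-1}{2q-1}\right)^{1-\frac1q}L^{\frac1q}\bigl(a^{(s^2-s+1)q/2},b^{(s^2-s+1)q/2}\bigr)\,A\Bigl(G\bigl(a^{-(s-1)^2},b^{s}\bigr),\,G\bigl(a^{s},b^{-(s-1)^2}\bigr)\Bigr).$$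
   Context: For positive real numbers $x,y$: $A(x,y)=\frac{x+y}{2}$ is the arithmetic mean, $G(x,y)=\sqrt{xy}$ is the geometric mean, and, for $x\ne y$, $L(x,y)=\frac{y-x}{\ln y-\ln x}$ is the logarithmic mean. $G^{r}(x,y)$ and $L^{r}(x,y)$ mean $(G(x,y))^{r}$ and $(L(x,y))^{r}$. *)

(* Defs.v *)
From Stdlib Require Import Reals.
Local Open Scope R_scope.

Definition arith_mean (x y : R) : R := (x + y) / 2.

Definition geom_mean (x y : R) : R := sqrt (x * y).

(* Meaningful only for positive x <> y. *)
Definition log_mean (x y : R) : R := (y - x) / (ln y - ln x).

(* Main.v *)
(* Jensen's inequality gives [L(a^(rq), b^(rq))^(1/q) >= L(a^r, b^r)], Bernoulli's
   inequality gives [L(a^r, b^r) >= a^(r-s) L(a^s, b^s)] for [r >= s] and shows that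
   the constant [((q-1)/(2q-1))^(1-1/q)] is at least [1/2].  With [r = s + (s-1)^2]
   and [b <= 1], the two right-hand sides are therefore at least [(b^s - a^s)/2] and
   [(b^s - a^s)/4].  These already bound [|A - L|] and [|G^s - L|], so Hölder's
   inequality is not needed. *)
Require Import Defs.
From Stdlib Require Import Reals Lra Psatz.
From Coquelicot Require Import Coquelicot.
Local Open Scope R_scope.

(** * Bernoulli's inequality for powers of [exp x], and the constant factor *)

Lemma bernoulli_exp (q x : R) : 1 <= q -> 1 + q * (exp x - 1) <= exp (q * x).
Proof.
intros hq.
(* Divide by [exp x] and use [exp t >= 1 + t] at [(q - 1) x] and at [- x]. *)
assert (H1 := exp_ineq1_le ((q - 1) * x)).
assert (H2 := exp_ineq1_le (- x)).
assert (Ex := exp_pos x).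
assert (E1 : exp (q * x) = exp x * exp ((q - 1) * x)).
{ rewrite <- exp_plus. f_equal. ring. }
assert (E2 : exp x * exp (- x) = 1).
{ rewrite <- exp_plus, Rplus_opp_r. apply exp_0. }
rewrite E1.
assert (H3 := Rmult_le_compat_l _ _ _ (Rlt_le _ _ Ex) H1).
assert (H4 : (q - 1) * (exp x * (1 + - x)) <= (q - 1) * (exp x * exp (- x))).
{ apply Rmult_le_compat_l; [lra|]. apply Rmult_le_compat_l; lra. }
rewrite E2 in H4.
nra.
Qed.

(** With the conjugate exponent [p = q / (q - 1)] the constant is [C = (1 + p)^(-1/p)]. Bernoulli's
    inequality gives [1 + p = (1/C)^p >= 1 + p (1/C - 1)], hence [1/C <= 2]. *)
Lemma hoelder_constant_ge_half (q : R) :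
  1 < q -> 1 / 2 <= Rpower ((q - 1) / (2 * q - 1)) (1 - 1 / q).
Proof.
intros hq.
assert (hq' : 1 <= q / (q - 1)).
{ apply Rmult_le_reg_r with (q - 1); [lra|]. field_simplify; lra. }
unfold Rpower.
set (y := (1 - 1 / q) * ln ((q - 1) / (2 * q - 1))).
assert (hpos : 0 < (q - 1) / (2 * q - 1)) by (apply Rdiv_lt_0_compat; lra).
assert (B := bernoulli_exp (q / (q - 1)) (- y) hq').
replace (q / (q - 1) * - y) with (- ln ((q - 1) / (2 * q - 1))) in B
  by (unfold y; field; lra).
rewrite !exp_Ropp, exp_ln in B by assumption.
assert (Ey := exp_pos y).
assert (H : / exp y <= 2).
{ apply Rmult_le_reg_l with (q / (q - 1)); [lra|].
  replace (/ ((q - 1) / (2 * q - 1))) with (q / (q - 1) + 1) in B by (field; lra).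
  lra. }
apply Rmult_le_compat_l with (r := exp y) in H; [|lra].
rewrite Rinv_r in H; lra.
Qed.

(** * Lower bounds for logarithmic means of exponentials *)

Lemma log_mean_exp (x y : R) : log_mean (exp x) (exp y) = (exp y - exp x) / (y - x).
Proof. unfold log_mean. now rewrite !ln_exp. Qed.

Lemma log_mean_exp_pos (x y : R) : x < y -> 0 < log_mean (exp x) (exp y).
Proof.
intros hxy. rewrite log_mean_exp.
assert (H := exp_increasing _ _ hxy). apply Rdiv_lt_0_compat; lra.
Qed.

Lemma log_mean_exp_le_power (x y q : R) : x < y -> 1 <= q ->
  log_mean (exp x) (exp y)
  <= Rpower (log_mean (exp (q * x)) (exp (q * y))) (1 / q).
Proof.
intros hxy hq.
assert (cpos := log_mean_exp_pos x y hxy).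
assert (Ec := log_mean_exp x y).
set (c := log_mean (exp x) (exp y)) in *.
assert (hqxy : q * x < q * y) by nra.
assert (Lpos := log_mean_exp_pos _ _ hqxy).
(* Integrate over [x <= t <= y] the tangent inequality at [c] of [z |-> z^q],
   taken at [z = exp t], whose linear term has mean [0]. *)
assert (key : exp (q * ln c) <= log_mean (exp (q * x)) (exp (q * y))).
{ destruct (MVT_cor2
    (fun t => exp (q * t) / q - exp (q * ln c) * (t + q * (exp t / c - t)))
    (fun t => exp (q * t) - exp (q * ln c) * (1 + q * (exp t / c - 1)))
    x y hxy) as [t [Ht _]].
  { intros t _. apply is_derive_Reals. auto_derive; [easy|]. field; lra. }
  assert (B := bernoulli_exp q (t - ln c) hq).
  assert (Et : exp (t - ln c) = exp t / c).
  { unfold Rminus. rewrite exp_plus, exp_Ropp, exp_ln; easy. }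
  rewrite Et in B.
  assert (B' : exp (q * ln c) * (1 + q * (exp t / c - 1)) <= exp (q * t)).
  { replace (q * t) with (q * ln c + q * (t - ln c)) by ring.
    rewrite exp_plus. apply Rmult_le_compat_l; [apply Rlt_le, exp_pos|exact B]. }
  assert (Exy : exp y / c - exp x / c = y - x).
  { assert (exp x < exp y) by now apply exp_increasing.
    rewrite Ec. field; lra. }
  assert (H : 0 <= exp (q * y) / q - exp (q * x) / q - exp (q * ln c) * (y - x)).
  { replace (exp (q * y) / q - exp (q * x) / q - exp (q * ln c) * (y - x))
      with (exp (q * y) / q - exp (q * ln c) * (y + q * (exp y / c - y))
            - (exp (q * x) / q - exp (q * ln c) * (x + q * (exp x / c - x)))).
    2:{ replace (exp y / c) with (exp x / c + (y - x)) by lra. ring. }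
    rewrite Ht. apply Rmult_le_pos; lra. }
  rewrite log_mean_exp.
  apply Rmult_le_reg_r with (y - x); [lra|].
  replace ((exp (q * y) - exp (q * x)) / (q * y - q * x) * (y - x))
    with (exp (q * y) / q - exp (q * x) / q) by (field; lra).
  lra. }
unfold Rpower.
rewrite <- (exp_ln c) at 1 by assumption.
replace (ln c) with (1 / q * (q * ln c)) by (field; lra).
assert (K : q * ln c <= ln (log_mean (exp (q * x)) (exp (q * y)))).
{ rewrite <- (ln_exp (q * ln c)). apply ln_le; [apply exp_pos|exact key]. }
assert (hq1 : 0 <= 1 / q) by (apply Rlt_le, Rdiv_lt_0_compat; lra).
destruct (Rmult_le_compat_l _ _ _ hq1 K) as [h|h].
- now apply Rlt_le, exp_increasing.
- rewrite h. apply Rle_refl.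
Qed.

(** Put [d = v - u]. After division by [exp (r * u)] the claim is that [(exp (t * d) - 1) / (t * d)]
    is no larger at [t = s] than at [t = r], which is Bernoulli's inequality with exponent [r / s]
    at [s * d]. *)
Lemma log_mean_exp_scale_le (u v s r : R) : u < v -> 0 < s -> s <= r ->
  exp ((r - s) * u) * log_mean (exp (s * u)) (exp (s * v))
  <= log_mean (exp (r * u)) (exp (r * v)).
Proof.
intros huv hs hr.
assert (hrs : 1 <= r / s).
{ apply Rmult_le_reg_r with s; [lra|]. field_simplify; lra. }
assert (B := bernoulli_exp (r / s) (s * (v - u)) hrs).
replace (r / s * (s * (v - u))) with (r * (v - u)) in B by (field; lra).
rewrite !log_mean_exp.
replace (s * v) with (s * u + s * (v - u)) at 1 by ring.
replace (r * v) with (r * u + r * (v - u)) at 1 by ring.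
rewrite !exp_plus.
replace (exp (r * u)) with (exp ((r - s) * u) * exp (s * u))
  by (rewrite <- exp_plus; f_equal; ring).
rewrite <- !Rmult_minus_distr_l.
set (P := exp ((r - s) * u) * exp (s * u)).
assert (hP : 0 < P) by (apply Rmult_lt_0_compat; apply exp_pos).
replace (exp ((r - s) * u)
         * ((exp (s * u) * exp (s * (v - u)) - exp (s * u)) / (s * (v - u))))
  with (P / (r * (v - u)) * (r / s * (exp (s * (v - u)) - 1)))
  by (unfold P; field; lra).
replace ((P * exp (r * (v - u)) - P) / (r * (v - u)))
  with (P / (r * (v - u)) * (exp (r * (v - u)) - 1)) by (field; lra).
apply Rmult_le_compat_l; [|lra].
apply Rlt_le, Rdiv_lt_0_compat; [assumption|apply Rmult_lt_0_compat; lra].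
Qed.

(** Serves both estimates of the theorem, the second one with halved exponents. *)
Lemma log_mean_exp_power_ge (u v s r q : R) :
  u < v -> 0 < s -> s <= r -> 1 <= q ->
  exp ((r - s) * u) * log_mean (exp (s * u)) (exp (s * v))
  <= Rpower (log_mean (exp (r * q * u)) (exp (r * q * v))) (1 / q).
Proof.
intros huv hs hr hq.
eapply Rle_trans; [now apply log_mean_exp_scale_le|].
replace (r * q * u) with (q * (r * u)) by ring.
replace (r * q * v) with (q * (r * v)) by ring.
apply log_mean_exp_le_power; nra.
Qed.

(** * Upper bounds for the two differences of means *)

(** Equivalent to the trapezoidal rule overestimating the integral of [exp] over [[0, h]]. The
    difference of the two sides vanishes at [0] and has derivative [1 - (1 - t) * exp t],
    nonnegative because [1 - t <= exp (- t)]. *)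
Lemma exp_trapezoid (h : R) : 0 < h -> (2 - h) * exp h <= 2 + h.
Proof.
intros hh.
destruct (MVT_cor2 (fun t => 2 + t - (2 - t) * exp t) (fun t => 1 - (1 - t) * exp t)
  0 h hh) as [t [Ht _]].
{ intros t _. apply is_derive_Reals. auto_derive; [easy|]. ring. }
rewrite exp_0 in Ht.
assert (H := exp_ineq1_le (- t)).
assert (Et := exp_pos t).
assert (E : exp t * exp (- t) = 1).
{ rewrite <- exp_plus, Rplus_opp_r. apply exp_0. }
assert (D : (1 - t) * exp t <= 1) by nra.
assert (0 <= (1 - (1 - t) * exp t) * (h - 0)) by (apply Rmult_le_pos; lra).
lra.
Qed.

Lemma arith_sub_log_mean_exp_le (x y : R) : x < y ->
  Rabs (arith_mean (exp x) (exp y) - log_mean (exp x) (exp y)) <= (exp y - exp x) / 2.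
Proof.
intros hxy. rewrite log_mean_exp. unfold arith_mean.
(* The claim says that [L] lies between [exp x] and [exp y]. *)
assert (H1 : exp x <= (exp y - exp x) / (y - x)).
{ apply Rmult_le_reg_r with (y - x); [lra|].
  replace ((exp y - exp x) / (y - x) * (y - x)) with (exp y - exp x) by (field; lra).
  assert (H := exp_ineq1_le (y - x)).
  replace (exp y) with (exp x * exp (y - x)) by (rewrite <- exp_plus; f_equal; ring).
  assert (Ex := exp_pos x). nra. }
assert (H2 : (exp y - exp x) / (y - x) <= exp y).
{ apply Rmult_le_reg_r with (y - x); [lra|].
  replace ((exp y - exp x) / (y - x) * (y - x)) with (exp y - exp x) by (field; lra).
  assert (H := exp_ineq1_le (x - y)).
  replace (exp x) with (exp y * exp (x - y)) by (rewrite <- exp_plus; f_equal; ring).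
  assert (Ey := exp_pos y). nra. }
apply Rabs_le. lra.
Qed.

(** With [h] half the difference of the exponents, [G] the geometric mean and [S = 2 sinh h], the
    logarithmic mean is [G * (S / (2 * h))]. Division by [G] leaves [|1 - S / (2 * h)| <= S / 4],
    that is, the bounds [U] and [L] below. *)
Lemma geom_sub_log_mean_exp_le (x y : R) : x < y ->
  Rabs (exp ((x + y) / 2) - log_mean (exp x) (exp y)) <= (exp y - exp x) / 4.
Proof.
intros hxy. rewrite log_mean_exp.
set (h := (y - x) / 2). set (G := exp ((x + y) / 2)).
assert (hh : 0 < h) by (unfold h; lra).
assert (GP : 0 < G) by apply exp_pos.
replace (y - x) with (2 * h) by (unfold h; lra).
replace (exp y) with (G * exp h)
  by (unfold G, h; rewrite <- exp_plus; f_equal; field).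
replace (exp x) with (G * exp (- h))
  by (unfold G, h; rewrite <- exp_plus; f_equal; field).
assert (H1 := exp_trapezoid h hh).
assert (H2 := exp_ineq1_le h).
assert (H3 := exp_ineq1_le (- h)).
assert (Eh := exp_pos (- h)).
assert (E : exp h * exp (- h) = 1).
{ rewrite <- exp_plus, Rplus_opp_r. apply exp_0. }
set (S := exp h - exp (- h)).
replace ((G * exp h - G * exp (- h)) / (2 * h)) with (G * (S / (2 * h)))
  by (unfold S; field; lra).
replace ((G * exp h - G * exp (- h)) / 4) with (G * (S / 4)) by (unfold S; field).
(* For [h <= 2], [H1] and [exp (- h) >= 1 - h] give even [4 * h - h^2] as a bound; for [h > 2] the
   left side is negative. *)
assert (U : (2 - h) * S <= 4 * h).
{ unfold S. destruct (Rle_lt_dec h 2); nra. }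
(* Here [S >= (1 + h) - 1 / (1 + h) = h (2 + h) / (1 + h)], and [(2 + h)^2 >= 4 (1 + h)]. *)
assert (L : 4 * h <= (2 + h) * S).
{ assert (M : (1 + h) * exp (- h) <= 1) by nra.
  unfold S. nra. }
assert (U' : S / (2 * h) - S / 4 <= 1).
{ apply Rmult_le_reg_r with (4 * h); [lra|]. field_simplify; lra. }
assert (L' : 1 <= S / (2 * h) + S / 4).
{ apply Rmult_le_reg_r with (4 * h); [lra|]. field_simplify; lra. }
apply Rabs_le. nra.
Qed.

(** * Exponential coordinates and the two estimates *)

Lemma geom_mean_exp (x y : R) : geom_mean (exp x) (exp y) = exp ((x + y) / 2).
Proof.
unfold geom_mean. rewrite <- exp_plus.
replace (x + y) with ((x + y) / 2 + (x + y) / 2) at 1 by field.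
rewrite exp_plus. apply sqrt_square, Rlt_le, exp_pos.
Qed.

Lemma Rpower_exp (x y : R) : Rpower (exp x) y = exp (y * x).
Proof. unfold Rpower. now rewrite ln_exp. Qed.

Lemma exp_ge_1 (x : R) : 0 <= x -> 1 <= exp x.
Proof. intros hx. assert (H := exp_ineq1_le x). lra. Qed.

Theorem proposition2 (a b s q : R)
  (ha : 0 < a) (hab : a < b) (hb : b <= 1)
  (hs0 : 0 < s) (hs1 : s < 1) (hq : 1 < q) :
  Rabs (arith_mean (Rpower a s) (Rpower b s)
        - log_mean (Rpower a s) (Rpower b s))
  <= s * (b - a)
       / (log_mean a b * Rpower (geom_mean a b) (2 * (s - 1) ^ 2))
     * Rpower ((q - 1) / (2 * q - 1)) (1 - 1 / q)
     * Rpower (log_mean (Rpower a ((s ^ 2 - s + 1) * q))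
                        (Rpower b ((s ^ 2 - s + 1) * q)))
              (1 / q)
  /\
  Rabs (Rpower (geom_mean a b) s
        - log_mean (Rpower a s) (Rpower b s))
  <= s * (b - a)
       / (2 * log_mean a b * Rpower (geom_mean a b) ((s - 1) ^ 2))
     * Rpower ((q - 1) / (2 * q - 1)) (1 - 1 / q)
     * Rpower (log_mean (Rpower a ((s ^ 2 - s + 1) * q / 2))
                        (Rpower b ((s ^ 2 - s + 1) * q / 2)))
              (1 / q)
     * arith_mean
         (geom_mean (Rpower a (- (s - 1) ^ 2)) (Rpower b s))
         (geom_mean (Rpower a s) (Rpower b (- (s - 1) ^ 2))).
Proof.
(* Write [a = exp u] and [b = exp v]; the hypotheses become [u < v <= 0], and all powers and means
   turn into exponentials. *)
rewrite <- (exp_ln a), <- (exp_ln b) by lra.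
assert (huv : ln a < ln b) by now apply ln_increasing.
assert (hv : ln b <= 0) by (rewrite <- ln_1; apply ln_le; lra).
generalize dependent (ln a); generalize dependent (ln b).
intros v hv u huv. clear a b ha hab hb.
rewrite !geom_mean_exp, !Rpower_exp, !geom_mean_exp.
set (C := Rpower ((q - 1) / (2 * q - 1)) (1 - 1 / q)).
assert (HC : 1 / 2 <= C) by now apply hoelder_constant_ge_half.
set (m := (s - 1) ^ 2).
assert (hm : 0 <= m) by apply pow2_ge_0.
replace (s ^ 2 - s + 1) with (s + m) by (unfold m; ring).
assert (hd : exp v - exp u <> 0) by (assert (H := exp_increasing _ _ huv); lra).
assert (hsuv : s * u < s * v) by nra.
split.
- eapply Rle_trans; [now apply arith_sub_log_mean_exp_le|].
  assert (K := log_mean_exp_power_ge u v s (s + m) q huv hs0 ltac:(lra) ltac:(lra)).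
  set (P := Rpower _ (1 / q)) in *.
  rewrite log_mean_exp in K.
  assert (H1 : exp (m * u) * ((exp (s * v) - exp (s * u)) / (s * v - s * u)) <= P)
    by (now replace m with (s + m - s) by ring).
  rewrite log_mean_exp.
  (* The factor [b - a] cancels against the numerator of [L(a, b)]. *)
  replace (s * (exp v - exp u) / ((exp v - exp u) / (v - u) * exp (2 * m * ((u + v) / 2))))
    with (s * (v - u) * exp (- (m * (u + v)))).
  2:{ replace (2 * m * ((u + v) / 2)) with (m * (u + v)) by field.
      rewrite exp_Ropp. field. repeat split; try lra.
      apply Rgt_not_eq, exp_pos. }
  set (D := exp (s * v) - exp (s * u)) in *.
  assert (hD : 0 < D) by (assert (H := exp_increasing _ _ hsuv); unfold D; lra).
  set (w := s * (v - u)) in *.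
  assert (hw : 0 < w) by (unfold w; nra).
  replace (s * v - s * u) with w in H1 by (unfold w; ring).
  (* This is where [b <= 1] enters: the denominator contributes [exp (- (m * (u + v)))], the bound
     [H1] contributes [exp (m * u)], and their product is [b^(-m) >= 1]. *)
  assert (E1 : 1 <= exp (- (m * v))) by (apply exp_ge_1; nra).
  assert (H2 : D / w <= exp (- (m * (u + v))) * P).
  { apply Rle_trans with (exp (- (m * v)) * (D / w)).
    - rewrite <- (Rmult_1_l (D / w)) at 1. apply Rmult_le_compat_r; [|exact E1].
      apply Rlt_le, Rdiv_lt_0_compat; lra.
    - replace (- (m * v)) with (- (m * (u + v)) + m * u) by ring.
      rewrite exp_plus, Rmult_assoc.
      apply Rmult_le_compat_l; [apply Rlt_le, exp_pos|exact H1]. }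
  replace (D / 2) with (w * (1 / 2 * (D / w))) by (field; lra).
  replace (w * exp (- (m * (u + v))) * C * P)
    with (w * (C * (exp (- (m * (u + v))) * P))) by ring.
  apply Rmult_le_compat_l; [lra|].
  apply Rmult_le_compat; try lra.
  apply Rlt_le, Rdiv_lt_0_compat; lra.
- replace (s * ((u + v) / 2)) with ((s * u + s * v) / 2) by field.
  eapply Rle_trans; [now apply geom_sub_log_mean_exp_le|].
  (* The exponents are halved because [b^s - a^s] factors as [(Y - X) * (Y + X)] with [X = a^(s/2)]
     and [Y = b^(s/2)]. The logarithmic mean on the right controls [Y - X], the arithmetic mean
     controls [X + Y]. *)
  assert (K := log_mean_exp_power_ge u v (s / 2) ((s + m) / 2) q huv
                 ltac:(lra) ltac:(lra) ltac:(lra)).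
  replace ((s + m) / 2 * q) with ((s + m) * q / 2) in K by field.
  set (P := Rpower _ (1 / q)) in *.
  rewrite log_mean_exp in K.
  replace ((s + m) / 2 - s / 2) with (m / 2) in K by field.
  rewrite log_mean_exp.
  replace (s * (exp v - exp u)
           / (2 * ((exp v - exp u) / (v - u)) * exp (m * ((u + v) / 2))))
    with (s * (v - u) / 2 * exp (- (m * ((u + v) / 2)))).
  2:{ rewrite exp_Ropp. field. repeat split; try lra.
      apply Rgt_not_eq, exp_pos. }
  set (X := exp (s / 2 * u)) in *. set (Y := exp (s / 2 * v)) in *.
  assert (hX : 0 < X) by apply exp_pos.
  assert (hXY : X < Y) by (apply exp_increasing; nra).
  replace (exp (s * u)) with (X * X) by (unfold X; rewrite <- exp_plus; f_equal; field).
  replace (exp (s * v)) with (Y * Y) by (unfold Y; rewrite <- exp_plus; f_equal; field).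
  set (w := s * (v - u) / 2) in *.
  assert (hw : 0 < w) by (unfold w; nra).
  replace (s / 2 * v - s / 2 * u) with w in K by (unfold w; field).
  assert (hDw : 0 < (Y - X) / w) by (apply Rdiv_lt_0_compat; lra).
  assert (E1 : 1 <= exp (- (m * v / 2))) by (apply exp_ge_1; nra).
  assert (H2 : (Y - X) / w <= exp (- (m * ((u + v) / 2))) * P).
  { apply Rle_trans with (exp (- (m * v / 2)) * ((Y - X) / w)).
    - rewrite <- (Rmult_1_l ((Y - X) / w)) at 1. apply Rmult_le_compat_r; lra.
    - replace (- (m * v / 2)) with (- (m * ((u + v) / 2)) + m / 2 * u) by field.
      rewrite exp_plus, Rmult_assoc.
      apply Rmult_le_compat_l; [apply Rlt_le, exp_pos|exact K]. }
  (* The two geometric means are [a^(-m/2) * Y] and [b^(-m/2) * X], with both extra factors at least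
     [1]. *)
  assert (HA : (X + Y) / 2
    <= arith_mean (exp ((- m * u + s * v) / 2)) (exp ((s * u + - m * v) / 2))).
  { unfold arith_mean.
    replace ((- m * u + s * v) / 2) with (- (m * u / 2) + s / 2 * v) by field.
    replace ((s * u + - m * v) / 2) with (- (m * v / 2) + s / 2 * u) by field.
    rewrite !exp_plus. fold X Y.
    assert (E2 : 1 <= exp (- (m * u / 2))) by (apply exp_ge_1; nra).
    nra. }
  set (A := arith_mean _ _) in *.
  replace ((Y * Y - X * X) / 4)
    with (w * (1 / 2 * ((Y - X) / w)) * ((X + Y) / 2)) by (field; lra).
  replace (w * exp (- (m * ((u + v) / 2))) * C * P)
    with (w * (C * (exp (- (m * ((u + v) / 2))) * P))) by ring.
  assert (H3 : 1 / 2 * ((Y - X) / w) <= C * (exp (- (m * ((u + v) / 2))) * P))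
    by (apply Rmult_le_compat; lra).
  apply Rmult_le_compat; try lra.
  + apply Rmult_le_pos; lra.
  + apply Rmult_le_compat_l; lra.
Qed.
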